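(* Let $Y\subset\mathbb{P}^5$ be a cubic fourfold of type U6. Then $Y$ contains a singular point of corank at least $4$. Conversely, if $Y$ contains a singular point of corank $4$ or more, then $Y$ is of type U6. In particular, a cone over a cubic threefold is unstable.
   Context: We work over $\mathbb{C}$. A cubic fourfold is a hypersurface in $\mathbb{P}^5$ given by a nonzero cubic form in $x_0,\dots,x_5$. It is of type U6 if in suitable linear coordinates its equation is a linear combination of cubic monomials $x_0^{i_0}\cdots x_5^{i_5}$ of weight $\sum i_ja_j<0$, where $(a_0,\dots,a_5)=(11,-1,-1,-1,-1,-7)$. Unstable means not semistable in the GIT sense for $\mathrm{SL}(6)$ acting on $\mathbb{P}(\mathrm{Sym}^3W)$, $W=H^0(\mathbb{P}^5,\mathcal{O}(1))$. The corank of a hypersurface singularity $f(y_1,\dots,y_n)=0$ at the origin is $n$ minus the rank of the Hessian of $f$ at the origin (here $n=5$). *)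

(* Defs.v *)
From HB Require Import structures.
From mathcomp Require Import all_boot all_order all_algebra.
From mathcomp Require Import mpoly.
From mathcomp Require Import reals.
From mathcomp Require Import complex.

Set Implicit Arguments.
Unset Strict Implicit.
Unset Printing Implicit Defensive.

Import GRing.Theory.

Local Open Scope ring_scope.

(* A hypersurface of degree d in P^n is represented by its equation, a nonzero
   element of [dhomog n.+1 K d], the space Sym^d W of forms of degree d in the
   homogeneous coordinates 'X_0, ..., 'X_n, where W = H^0(P^n, O(1)). *)

(* The action of a matrix A on Sym^d W induced by the linear endomorphism of W
   sending 'X_i to \sum_j A j i *: 'X_j (A acts on columns of coordinates with
   respect to the basis 'X_0, ..., 'X_n of W, so this is a left action). *)
Definition lin_image (K : fieldType) (n : nat) (A : 'M[K]_n) (i : 'I_n) :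
    {mpoly K[n]} :=
  \sum_(j < n) A j i *: 'X_j.

Lemma lin_subst_dhomog (K : fieldType) (n d : nat) (A : 'M[K]_n)
    (f : dhomog n K d) :
  mpoly_of_dhomog f \mPo [tuple lin_image A i | i < n] \is d.-homog.
Proof.
rewrite comp_mpolyEX big_seq rpred_sum // => m mf; apply: rpredZ.
have <- : mdeg m = d by exact: (dhomogP _ _ _ (dhomog_is_dhomog f)).
rewrite comp_mpolyX mdegE; elim/big_ind2 : _ => [|d1 q1 d2 q2 h1 h2|i _].
- exact: dhomog1.
- exact: dhomogM.
- rewrite tnth_mktuple.
  have /(dhomogMn (m i)) : lin_image A i \is 1.-homog.
    by apply: rpred_sum => j _; apply: rpredZ; rewrite dhomogX /= mdeg1.
  by rewrite mul1n.
Qed.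

Definition lin_subst (K : fieldType) (n d : nat) (A : 'M[K]_n)
    (f : dhomog n K d) : dhomog n K d :=
  DHomog (lin_subst_dhomog A f).

Definition mnm_weight (n : nat) (a : n.-tuple int) (m : 'X_{1..n}) : int :=
  \sum_(j < n) (m j)%:Z * tnth a j.

Definition u6_weights : 6.-tuple int := [tuple 11; -1; -1; -1; -1; -7].

Definition type_U6 (K : fieldType) (f : dhomog 6 K 3) : Prop :=
  exists2 A : 'M[K]_6, A \in unitmx &
    forall m, m \in msupp (lin_subst A f) -> mnm_weight u6_weights m < 0.

(* Points of P(V) are the lines of V, so that sections of O(k) on P(V) are the
   homogeneous polynomials of degree k on V, here expressed in the coordinates
   with respect to a basis of V = Sym^d W. *)
Definition poly_eval (K : fieldType) (V : vectType K)
    (P : {mpoly K[\dim {: V}]}) (v : V) : K :=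
  P.@[fun i => coord (vbasis {: V}) i v].

Definition SL_invariant (K : fieldType) (n d : nat)
    (P : {mpoly K[\dim {: dhomog n.+1 K d}]}) : Prop :=
  forall (A : 'M[K]_n.+1) (f : dhomog n.+1 K d),
    \det A = 1 -> poly_eval P (lin_subst A f) = poly_eval P f.

Definition semistable (K : fieldType) (n d : nat) (f : dhomog n.+1 K d) : Prop :=
  exists (k : nat) (P : {mpoly K[\dim {: dhomog n.+1 K d}]}),
    [/\ (0 < k)%N, P \is k.-homog, SL_invariant P & poly_eval P f != 0].

Definition unstable (K : fieldType) (n d : nat) (f : dhomog n.+1 K d) : Prop :=
  ~ semistable f.

(* Equation of the hypersurface in the affine chart 'X_i <> 0, in the affine
   coordinates y_k = 'X_j / 'X_i - p_j / p_i (j = lift i k) centred at the point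
   p, which is assumed to satisfy p_i <> 0. *)
Definition local_equation (K : fieldType) (n : nat) (f : {mpoly K[n.+1]})
    (p : 'rV[K]_n.+1) (i : 'I_n.+1) : {mpoly K[n]} :=
  f \mPo [tuple (if unlift i j is Some k then 'X_k + (p 0 j / p 0 i)%:MP else 1)
         | j < n.+1].

Definition singular_at_origin (K : fieldType) (n : nat) (g : {mpoly K[n]}) :
    Prop :=
  g.@[fun=> 0] = 0 /\ forall k, g^`M(k).@[fun=> 0] = 0.

Definition hessian_at_origin (K : fieldType) (n : nat) (g : {mpoly K[n]}) :
    'M[K]_n :=
  \matrix_(k, l) g^`M(k)^`M(l).@[fun=> 0].

Definition corank_at_origin (K : fieldType) (n : nat) (g : {mpoly K[n]}) : nat :=
  n - \rank (hessian_at_origin g).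

(* The choice of the chart is irrelevant: another chart changes the local
   equation by a local isomorphism and a unit. *)
Definition has_singular_point_of_corank_ge (K : fieldType) (n d r : nat)
    (f : dhomog n.+1 K d) : Prop :=
  exists (p : 'rV[K]_n.+1) (i : 'I_n.+1),
    [/\ p 0 i != 0, singular_at_origin (local_equation f p i)
      & (r <= corank_at_origin (local_equation f p i))%N].

(* In suitable coordinates, f is the equation g of a hypersurface of degree d in
   P^(n-1), in the variables 'X_1, ..., 'X_n: a cone with vertex [1 : 0 : ...]. *)
Definition is_cone (K : fieldType) (n d : nat) (f : dhomog n.+1 K d) : Prop :=
  exists (A : 'M[K]_n.+1) (g : dhomog n K d),
    [/\ A \in unitmx, g != 0
      & lin_subst A f
        = mpoly_of_dhomog g \mPo [tuple 'X_(lift ord0 k) | k < n]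
        :> {mpoly K[n.+1]}].

(* Main.v *)
Require Import Defs.
From mathcomp Require Import all_boot all_order fingroup perm all_algebra.
From mathcomp Require Import mpoly.
From mathcomp Require Import reals.
From mathcomp Require Import complex.
From mathcomp Require Import zify ring.

Set Implicit Arguments.
Unset Strict Implicit.
Unset Printing Implicit Defensive.

Import Order.TTheory GRing.Theory Num.Theory.

Local Open Scope ring_scope.
Local Open Scope complex_scope.

(* Both conditions are read off the full Hessian H(q) of the cubic form f at a
   vector q. For a cubic h, the entries of its Hessian at e_0 are, up to nonzero
   integers, the coefficients of x_0 x_a x_b, and the only monomial of negative
   weight divisible by x_0 is x_0 x_5^2; so f is of type U6 iff A H(e_0 A) A^T
   is a multiple of E_55 for some invertible A. By Euler's formula, q is a
   singular point iff q H(q) = 0, and then H(q) has the same rank as the Hessian of the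
   local equation. A symmetric matrix of rank at most 1 killed by q is c v^T v
   with q v^T = 0, and a basis starting with q and adapted to the hyperplane
   v = 0 brings it to the form c E_55.
   A cone is multiplied by s^d under diag(a, s, ..., s) in adapted coordinates,
   with a chosen to have determinant 1, so that an invariant form takes the same
   value at h and at 2^d h. *)

(** * Chain rule, Euler's formula and scaling for homogeneous polynomials *)

Section PolynomialCalculus.

Variable K : fieldType.

(** Both sides are additive in [p], and by the Leibniz rule the identity passes to products; this
    reduces the chain rule to the variables, which give all monomials. *)
Lemma mderiv_comp n m (p : {mpoly K[n]}) (t : n.-tuple {mpoly K[m]}) k :
  (p \mPo t)^`M(k) = \sum_i (p^`M(i) \mPo t) * (tnth t i)^`M(k).
Proof.
pose D q := (q \mPo t)^`M(k) = \sum_i (q^`M(i) \mPo t) * (tnth t i)^`M(k).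
have DM q r : D q -> D r -> D (q * r).
  rewrite /D => hq hr; rewrite rmorphM /= mderivM hq hr mulr_suml mulr_sumr.
  rewrite -big_split; apply: eq_bigr => i _ /=.
  by rewrite mderivM rmorphD !rmorphM /= mulrDl mulrAC mulrA.
have D1 : D 1.
  rewrite /D comp_mpoly1 -mpolyC1 mderivC big1 // => i _.
  by rewrite mderivC comp_mpoly0 mul0r.
have DX i : D 'X_i.
  rewrite /D comp_mpolyXU -tnth_nth (bigD1 i) //= big1 => [|j ji].
    rewrite mderivX mnm1E eqxx scale1r -[X in (X - _)%MM]add0m addmK mpolyX0.
    by rewrite comp_mpoly1 mul1r addr0.
  by rewrite mderivX mnm1E eq_sym (negPf ji) scale0r comp_mpoly0 mul0r.
have DXm (q : 'X_{1..n}) : D 'X_[q].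
  rewrite mpolyXE_id; elim/big_ind: _ => // i _; elim: (q i) => [|e ihe] //.
  by rewrite exprS; apply: DM.
rewrite -/(D p); elim/mpolyind: p => [|c q p _ _ Dp].
  rewrite /D comp_mpoly0 mderiv0 big1 // => i _.
  by rewrite mderiv0 comp_mpoly0 mul0r.
rewrite /D comp_mpolyD comp_mpolyZ mderivD mderivZ DXm Dp scaler_sumr.
rewrite -big_split; apply: eq_bigr => i _ /=.
by rewrite mderivD mderivZ comp_mpolyD comp_mpolyZ mulrDl scalerAl.
Qed.

Lemma dhomog_mderiv n d (p : {mpoly K[n]}) i :
  p \is d.+1.-homog -> p^`M(i) \is d.-homog.
Proof.
move=> /dhomogP hp; apply/dhomogP => m.
rewrite mcoeff_msupp mcoeff_deriv => nz.
have /hp : (m + U_(i))%MM \in msupp p.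
  by rewrite mcoeff_msupp; apply: contraNneq nz => ->; rewrite mul0rn.
by rewrite /= mdegD mdeg1 addn1 => -[].
Qed.

(** Monomial by monomial: ['X_i] times the [i]-th derivative multiplies a monomial by its exponent
    [m i], and these exponents add up to [d]. *)
Lemma dhomog_euler n d (p : {mpoly K[n]}) :
  p \is d.-homog -> \sum_i 'X_i * p^`M(i) = p *+ d.
Proof.
move=> /dhomogP hp; rewrite {2}[p]mpolyE -sumrMnl.
under eq_bigr => i _ do rewrite {1}[p]mpolyE raddf_sum mulr_sumr.
rewrite exchange_big /= !big_seq; apply: eq_bigr => m /hp /= md.
rewrite scalerMnr -md mdegE -sumrMnr scaler_sumr; apply: eq_bigr => i _.
rewrite mderivZ mderivX -!scalerAr -mpolyXD scaler_nat.
have [->|mi] := posnP (m i); first by rewrite !mulr0n.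
by rewrite addmC submK // lep1mP -lt0n.
Qed.

Lemma meval_dhomog_euler n d (p : {mpoly K[n]}) v :
  p \is d.-homog -> \sum_i v i * p^`M(i).@[v] = d%:R * p.@[v].
Proof.
move=> /dhomog_euler /(congr1 (meval v)).
rewrite raddf_sum mevalMn mulr_natl => <-; apply: eq_bigr => i _ /=.
by rewrite mevalM mevalXU.
Qed.

Lemma comp_mpoly_dhomogZ n m d (p : {mpoly K[n]}) c
    (t u : n.-tuple {mpoly K[m]}) :
  p \is d.-homog -> (forall i, tnth u i = c *: tnth t i) ->
  p \mPo u = c ^+ d *: (p \mPo t).
Proof.
move=> /dhomogP hp tu; rewrite !comp_mpolyEX scaler_sumr !big_seq.
apply: eq_bigr => e /hp /= <-; rewrite !scalerA mulrC -scalerA.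
congr (_ *: _); rewrite !comp_mpolyX mdegE.
under [LHS]eq_bigr do rewrite tu exprZn.
by rewrite scaler_prod prodrXr.
Qed.

Lemma meval_dhomogZ n d (p : {mpoly K[n]}) c (v w : 'I_n -> K) :
  p \is d.-homog -> (forall i, w i = c * v i) -> p.@[w] = c ^+ d * p.@[v].
Proof.
move=> /dhomogP hp vw; rewrite !mevalE mulr_sumr !big_seq.
apply: eq_bigr => e /hp /= <-; rewrite mulrCA; congr (_ * _).
rewrite mdegE -prodrXr -big_split; apply: eq_bigr => i _ /=.
by rewrite vw exprMn.
Qed.

(** Used to read second derivatives of a cubic at a basis vector as coefficients. Derivatives of a
    linear form have degree 0, hence are constants, and Euler's formula rebuilds the form from
    them. *)
Lemma meval_dhomog1_delta n (p : {mpoly K[n]}) (v : 'I_n -> K) k :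
  p \is 1.-homog -> (forall i, v i = (i == k)%:R) -> p.@[v] = p@_U_(k).
Proof.
move=> hp vk; have := dhomog_euler hp; rewrite mulr1n => <-.
rewrite !raddf_sum /=; apply: eq_bigr => i _.
have /dhomogP hq := dhomog_mderiv i hp.
have -> : p^`M(i) = (p^`M(i)@_0)%:MP.
  apply/mpolyP => m; rewrite mcoeffC.
  have [->|m0] := eqVneq; first by rewrite mulr1.
  rewrite mulr0; apply: contraNeq m0.
  by rewrite -mcoeff_msupp => /hq /= /eqP; rewrite mdeg_eq0.
by rewrite mevalM mevalXU mevalC vk [in RHS]mulrC mcoeffCM mcoeffXU mulrC.

Qed.

End PolynomialCalculus.

(** * The full Hessian: linear substitutions, affine charts and singular points *)

Section Hessian.

Variable K : fieldType.

(** Taken in all the homogeneous coordinates and at a vector, independently of any chart; the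
    Hessian of a local equation will be a submatrix of it. *)
Definition hessian_at n (f : {mpoly K[n]}) (v : 'rV[K]_n) : 'M[K]_n :=
  \matrix_(a, b) f^`M(a)^`M(b).@[v 0].

Lemma trmx_hessian_at n (f : {mpoly K[n]}) v :
  (hessian_at f v)^T = hessian_at f v.
Proof. by apply/matrixP => a b; rewrite !mxE mderiv_comm. Qed.

Lemma hessian_atZ n (f : {mpoly K[n]}) c v :
  f \is 3.-homog -> hessian_at f (c *: v) = c *: hessian_at f v.
Proof.
move=> hf; apply/matrixP => a b; rewrite !mxE -[in RHS](expr1 c).
by apply: meval_dhomogZ => [|i]; [do 2!apply: dhomog_mderiv | rewrite mxE].
Qed.

Lemma mderiv_lin_image n (A : 'M[K]_n) i k :
  (lin_image A i)^`M(k) = (A k i)%:MP.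
Proof.
rewrite /lin_image raddf_sum (bigD1 k) //= big1 => [|j jk].
  rewrite mderivZ mderivX mnm1E eqxx scale1r -[X in (X - _)%MM]add0m addmK.
  by rewrite mpolyX0 addr0 alg_mpolyC.
by rewrite mderivZ mderivX mnm1E (negPf jk) scale0r scaler0.
Qed.

Lemma mderiv_comp_lin n (p : {mpoly K[n]}) (A : 'M[K]_n) k :
  (p \mPo [tuple lin_image A i | i < n])^`M(k) =
  \sum_i A k i *: (p^`M(i) \mPo [tuple lin_image A i | i < n]).
Proof.
rewrite mderiv_comp; apply: eq_bigr => i _.
by rewrite tnth_mktuple mderiv_lin_image mulrC mul_mpolyC.
Qed.

Lemma meval_comp_lin n (p : {mpoly K[n]}) (A : 'M[K]_n) (v : 'rV[K]_n) :
  (p \mPo [tuple lin_image A i | i < n]).@[v 0] = p.@[(v *m A) 0].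
Proof.
rewrite comp_mpoly_meval; apply: meval_eq => i.
rewrite tnth_mktuple raddf_sum mxE; apply: eq_bigr => j _ /=.
by rewrite mevalZ mevalXU mulrC.
Qed.

(** The chain rule applied twice; the substitution being linear, no term with its second derivatives
    appears, which leaves a congruence. *)
Lemma hessian_at_lin_subst n d (A : 'M[K]_n) (f : dhomog n K d) v :
  hessian_at (lin_subst A f) v = A *m hessian_at f (v *m A) *m A^T.
Proof.
apply/matrixP => a b; rewrite !mxE /= mderiv_comp_lin.
rewrite (raddf_sum (mderiv b)) raddf_sum /=.
under [LHS]eq_bigr => i _.
  rewrite mderivZ mderiv_comp_lin mevalZ raddf_sum mulr_sumr /=.
  under eq_bigr => j _ do rewrite mevalZ meval_comp_lin mulrCA mulrC.
  over.
rewrite exchange_big; apply: eq_bigr => j _ /=.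
by rewrite mxE mulr_suml; apply: eq_bigr => i _; rewrite !mxE.
Qed.

(** In the chart, coordinate [i] is the constant 1 and the others are translated variables, so the
    chain rule leaves a single term with coefficient 1. *)
Lemma mderiv_local_equation n (f : {mpoly K[n.+1]}) (p : 'rV[K]_n.+1) i k :
  (local_equation f p i)^`M(k) = local_equation f^`M(lift i k) p i.
Proof.
rewrite /local_equation mderiv_comp (bigD1 (lift i k)) //= big1 => [|j jk].
  rewrite tnth_mktuple liftK mderivD mderivC !addr0 mderivX mnm1E eqxx scale1r.
  by rewrite -[X in (X - _)%MM]add0m addmK mpolyX0 mulr1.
rewrite tnth_mktuple; case: unliftP jk => [l ->|_ _]; last first.
  by rewrite -mpolyC1 mderivC mulr0.
rewrite (inj_eq lift_inj) => lk.
by rewrite mderivD mderivC addr0 mderivX mnm1E (negPf lk) scale0r mulr0.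
Qed.

Lemma meval_local_equation n (f : {mpoly K[n.+1]}) (p : 'rV[K]_n.+1) i :
  p 0 i != 0 ->
  (local_equation f p i).@[fun=> 0] = f.@[((p 0 i)^-1 *: p) 0].
Proof.
move=> pi0; rewrite comp_mpoly_meval; apply: meval_eq => j.
rewrite tnth_mktuple mxE; case: unliftP => [k _|->].
  by rewrite mevalD mevalXU mevalC add0r mulrC.
by rewrite meval1 mulVf.
Qed.

Lemma hessian_local_equation n (f : {mpoly K[n.+1]}) (p : 'rV[K]_n.+1) i :
  p 0 i != 0 ->
  hessian_at_origin (local_equation f p i) =
  row' i (col' i (hessian_at f ((p 0 i)^-1 *: p))).
Proof.
move=> pi0; apply/matrixP => k l.
by rewrite !mxE !mderiv_local_equation meval_local_equation.
Qed.

(** Since [q 0 i] is invertible, the relation [q *m M = 0] expresses row [i] through the others, so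
    deleting it keeps the row space. *)
Lemma mxrank_row' n m (M : 'M[K]_(n.+1, m)) (q : 'rV[K]_n.+1) i :
  q *m M = 0 -> q 0 i != 0 -> \rank (row' i M) = \rank M.
Proof.
move=> qM qi0; suff e : (row' i M :=: M)%MS by rewrite e.
apply/eqmxP/andP; split.
  by apply/row_subP => k; rewrite row'Esub row_rowsub row_sub.
have rowS k : (row (lift i k) M <= row' i M)%MS.
  by rewrite -[row _ _](row_rowsub (lift i)) -row'Esub row_sub.
apply/row_subP => j; case: (unliftP i j) => [k ->|->] //.
move: qM; rewrite mulmx_sum_row (bigD1_ord i) //= => /eqP.
rewrite addr_eq0 => /eqP /(congr1 (fun u => (q 0 i)^-1 *: u)).
rewrite scalerA mulVf // scale1r => ->.
by rewrite scalemx_sub // eqmx_opp summx_sub // => k _; rewrite scalemx_sub.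
Qed.

Lemma row_neq0P n (q : 'rV[K]_n) : reflect (exists i, q 0 i != 0) (q != 0).
Proof.
apply: (iffP idP) => [q0|[k]]; last by apply: contraNneq => ->; rewrite mxE.
apply/existsP; apply: contraNT q0 => /existsPn q0.
by apply/eqP/rowP => i; have := q0 i; rewrite mxE negbK => /eqP.
Qed.

Lemma hessian_at_eulerE n d (f : {mpoly K[n]}) v k :
  f \is d.+2.-homog ->
  (v *m hessian_at f v) 0 k = d.+1%:R * f^`M(k).@[v 0].
Proof.
move=> hf; rewrite -meval_dhomog_euler; last exact: dhomog_mderiv.
by rewrite mxE; apply: eq_bigr => i _; rewrite !mxE mderiv_comm.
Qed.

End Hessian.

(** Removes the charts from the definition. The factors 2 and 3 from Euler's formula can be
    cancelled in characteristic 0. *)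
Lemma has_singular_pointP (K : numFieldType) n r (f : dhomog n.+1 K 3) :
  has_singular_point_of_corank_ge r f <->
  exists q : 'rV[K]_n.+1, [/\ q != 0, q *m hessian_at f q = 0
    & (r <= n - \rank (hessian_at f q))%N].
Proof.
have hf : mpoly_of_dhomog f \is 3.-homog by exact: dhomog_is_dhomog.
(* Row [i] is redundant because [q] kills the Hessian, and column [i] likewise by symmetry. *)
have rankE q i : q *m hessian_at f q = 0 -> q 0 i != 0 ->
    \rank (row' i (col' i (hessian_at f q))) = \rank (hessian_at f q).
  move=> qH qi; rewrite (mxrank_row' (q := q)) //; last first.
    by rewrite col'Esub mulmx_colsub qH; apply/matrixP => a b; rewrite !mxE.
  by rewrite -mxrank_tr tr_col' trmx_hessian_at (mxrank_row' (q := q)).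
split=> [[p [i [pi0 [f0 df0]]]]|[q [q0 qH rk]]].
  rewrite /corank_at_origin hessian_local_equation //.
  set q := (p 0 i)^-1 *: p => rk.
  have qi : q 0 i = 1 by rewrite mxE mulVf.
  have {}f0 : f.@[q 0] = 0 by rewrite -meval_local_equation.
  have {}df0 k : f^`M(lift i k).@[q 0] = 0.
    by rewrite -meval_local_equation // -mderiv_local_equation.
  have qH : q *m hessian_at f q = 0.
    apply/rowP => k; rewrite (hessian_at_eulerE _ _ hf) !mxE.
    have [l ->|->] := unliftP i k; first by rewrite df0 mulr0.
    (* The chart does not see the derivative along [i]; Euler's formula recovers it from the value
       of [f] and the other derivatives, as [q 0 i = 1]. *)
    have := meval_dhomog_euler (q 0) hf; rewrite f0 mulr0 (bigD1_ord i) //= qi.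
    rewrite big1 => [|l _]; last by rewrite df0 mulr0.
    by rewrite mul1r addr0 => ->; rewrite mulr0.
  exists q; split=> //; last by rewrite -(rankE q i) ?qi ?oner_eq0.
  by apply/eqP => /rowP /(_ i) /eqP; rewrite qi mxE oner_eq0.
have [i qi0] := row_neq0P _ q0.
have c0 : (q 0 i)^-1 != 0 by rewrite invr_eq0.
(* The chart evaluates at the multiple of [q] whose [i]-th coordinate is 1, so the hypotheses are
   moved there; the Hessian of a cubic scales linearly. *)
set c := (q 0 i)^-1 in c0.
have cqH : (c *: q) *m hessian_at f (c *: q) = 0.
  by rewrite hessian_atZ // -scalemxAl -scalemxAr qH !scaler0.
have df0 k : f^`M(k).@[(c *: q) 0] = 0.
  have := hessian_at_eulerE (c *: q) k hf; rewrite cqH mxE => /esym/eqP.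
  by rewrite mulf_eq0 pnatr_eq0 => /eqP.
exists q, i; split=> //; first split.
- rewrite meval_local_equation //.
  have /esym/eqP := meval_dhomog_euler ((c *: q) 0) hf.
  rewrite big1 => [|k _]; last by rewrite df0 mulr0.
  by rewrite mulf_eq0 pnatr_eq0 => /eqP.
- by move=> k; rewrite mderiv_local_equation meval_local_equation.
rewrite /corank_at_origin hessian_local_equation // rankE //.
  by rewrite hessian_atZ // mxrank_scale_nz.
by rewrite mxE mulf_neq0.
Qed.

(** * Normal form of symmetric matrices of rank at most one *)

Section RankOne.

Variable K : fieldType.

Lemma mxrank_le1P m n (M : 'M[K]_(m, n)) : (\rank M <= 1)%N ->
  exists (u : 'cV[K]_m) (w : 'rV[K]_n), M = u *m w.
Proof.
rewrite leq_eqVlt ltnS leqn0 mxrank_eq0 => /orP[/eqP rk|/eqP ->]; last first.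
  by exists 0, 0; rewrite mul0mx.
have := mulmx_base M; move: (col_base M) (row_base M); rewrite rk => u w <-.
by exists u, w.
Qed.

(** If some [M k k] is nonzero, row [k] divided suitably gives [M]. Otherwise the vanishing 2 by 2
    minors and symmetry give [M a b ^+ 2 = M a a * M b b = 0]. *)
Lemma sym_mxrank_le1P n (M : 'M[K]_n) : M^T = M -> (\rank M <= 1)%N ->
  exists (c : K) (v : 'rV[K]_n), M = c *: (v^T *m v).
Proof.
move=> symM /mxrank_le1P [u [w defM]].
have ME a b : M a b = u a 0 * w 0 b by rewrite defM mxE big_ord1.
have MC a b : M a b = M b a by rewrite -[in LHS]symM mxE.
have [k Mkk|M0] := pickP (fun k => M k k != 0).
  exists (M k k)^-1, (row k M); apply/matrixP => a b.
  rewrite !mxE big_ord1 !mxE; apply: (mulfI Mkk); rewrite mulVKf // [M k a]MC.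
  by rewrite !ME; ring.
exists 0, 0; rewrite scale0r; apply/matrixP => a b; apply/eqP; rewrite mxE.
rewrite -sqrf_eq0 expr2 {2}MC (_ : _ * _ = M a a * M b b).
  by have /negbFE/eqP-> := M0 a; rewrite mul0r.
by rewrite !ME; ring.
Qed.

Lemma perm_two n (k l i j : 'I_n) : k != l -> i != j ->
  (* The first transposition sends [k] to [i]; the second moves the image of [l] to [j] and fixes
     [i]. *)
  exists s : 'S_n, s k = i /\ s l = j.
Proof.
move=> kl ij; exists (tperm k i * tperm (tperm k i l) j)%g.
have kil : tperm k i l != i.
  by rewrite -[X in _ != X](tpermL k i) (inj_eq perm_inj) eq_sym.
rewrite !permM tpermL; split; last by rewrite tpermL.
by rewrite (tpermD kil) 1?eq_sym.
Qed.

Lemma flag_basis n (q v : 'rV[K]_n.+2) : q != 0 -> v != 0 -> q *m v^T = 0 ->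
  exists A : 'M[K]_n.+2, [/\ A \in unitmx, delta_mx 0 ord0 *m A = q
    & A *m v^T = delta_mx ord_max 0].
Proof.
move=> /row_neq0P[i qi] v0 qv.
(* If [v] were supported at [i] alone, [q *m v^T] would be the nonzero scalar [q 0 i * v 0 i]. *)
have [j ji vj] : exists2 j, i != j & v 0 j != 0.
  have [j /andP[]|h] := pickP (fun j => (i != j) && (v 0 j != 0)).
    by exists j.
  have vE j : i != j -> v 0 j = 0.
    by move=> ij; have := h j; rewrite ij /= => /negbFE/eqP.
  case/row_neq0P: v0 => k; have [<-|/vE ->] := eqVneq i k; last by rewrite eqxx.
  move=> vi; have /matrixP/(_ 0 0)/eqP := qv.
  rewrite !mxE (bigD1 i) //= big1 => [|l li].
    by rewrite mxE addr0 mulf_eq0 (negPf qi) (negPf vi).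
  by rewrite mxE vE ?mulr0 // eq_sym.
have [s [s0 sm]] : exists s : 'S_n.+2, s ord0 = i /\ s ord_max = j.
  exact: perm_two.
pose e l : 'rV[K]_n.+2 := delta_mx 0 l.
(* [q] replaces the basis vector [e i], the last row is [e j] scaled so that [v] takes the value 1,
   and each other [e l] is corrected by a multiple of [e j] to lie in the hyperplane [v = 0]. *)
pose A := \matrix_k (if k == ord0 then q else
  if k == ord_max then (v 0 j)^-1 *: e j
  else e (s k) - (v 0 (s k) / v 0 j) *: e j).
have eE l l' : e l 0 l' = (l' == l)%:R by rewrite mxE eqxx.
have ev l : e l *m v^T = (v 0 l)%:M.
  by rewrite -rowE; apply/matrixP => a b; rewrite !mxE !ord1 eqxx.
exists A; split; last 1 first.
- apply/row_matrixP => k; rewrite row_mul rowK.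
  have [->|k0] := eqVneq k ord0.
    by rewrite qv; apply/rowP => a; rewrite !mxE ord1.
  have [->|km] := eqVneq k ord_max.
    rewrite -scalemxAl ev scale_scalar_mx mulVf //.
    by apply/rowP => a; rewrite !mxE ord1 !eqxx.
  rewrite mulmxBl -scalemxAl !ev scale_scalar_mx divfK // subrr.
  by apply/rowP => a; rewrite !mxE (negPf km).
- have A0 l : A ord0 l = q 0 l by rewrite mxE.
  have Am l : A ord_max l = (v 0 j)^-1 * (l == j)%:R.
    by rewrite mxE eqxx mxE eE.
  have Amid k l : k != ord0 -> k != ord_max ->
      A k l = (l == s k)%:R - v 0 (s k) / v 0 j * (l == j)%:R.
    by move=> /negPf k0 /negPf km; rewrite mxE k0 km !mxE eqxx.
  (* Triangular elimination: column [i] meets only the row [q], then column [s k] isolates each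
     middle row [k], and column [j] is left for the last row. *)
  rewrite -row_free_unit; apply: inj_row_free => x /rowP xA.
  have {}xA l : \sum_k x 0 k * A k l = 0 by have := xA l; rewrite !mxE.
  have x0 : x 0 ord0 = 0.
    have := xA i; rewrite (bigD1 ord0) //= big1 => [|k k0].
      by rewrite A0 addr0 => /eqP; rewrite mulf_eq0 (negPf qi) orbF => /eqP.
    have [->|km] := eqVneq k ord_max; first by rewrite Am (negPf ji) !mulr0.
    rewrite Amid // (negPf ji) mulr0 subr0 -s0 (inj_eq perm_inj) eq_sym.
    by rewrite (negPf k0) mulr0.
  have xmid k : k != ord_max -> x 0 k = 0.
    have [-> //|k0 km] := eqVneq k ord0.
    have sk : s k == j = false by rewrite -sm (inj_eq perm_inj) (negPf km).
    have := xA (s k); rewrite (bigD1 k) //= big1 => [|l lk].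
      by rewrite Amid // eqxx sk mulr0 subr0 mulr1 addr0.
    have [->|l0] := eqVneq l ord0; first by rewrite x0 mul0r.
    have [->|lm] := eqVneq l ord_max; first by rewrite Am sk !mulr0.
    by rewrite Amid // sk (inj_eq perm_inj) eq_sym (negPf lk) mulr0 subr0 mulr0.
  apply/rowP => k; rewrite mxE; have [->|/xmid //] := eqVneq k ord_max.
  have := xA j; rewrite (bigD1 ord_max) //= big1 => [|l lm].
    rewrite Am eqxx mulr1 addr0 => /eqP.
    by rewrite mulf_eq0 invr_eq0 (negPf vj) orbF => /eqP.
  by rewrite xmid // mul0r.
- by rewrite -rowE rowK.
Qed.

Lemma rank_one_form_normalize n (q : 'rV[K]_n.+2) (M : 'M[K]_n.+2) :
  q != 0 -> M^T = M -> q *m M = 0 -> (\rank M <= 1)%N ->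
  exists (A : 'M[K]_n.+2) (c : K), [/\ A \in unitmx, delta_mx 0 ord0 *m A = q
    & A *m M *m A^T = c *: delta_mx ord_max ord_max].
Proof.
move=> q0 symM qM /(sym_mxrank_le1P symM)[c [v defM]].
(* An adapted basis requires a nonzero [v']. When [M = 0], take [c' = 0] and the form with
   coefficients [q 0 i] at [j] and [- q 0 j] at [i], which vanishes at [q]. *)
have [c' [v' [v'0 qv' defM']]] : exists (c' : K) (v' : 'rV[K]_n.+2),
    [/\ v' != 0, q *m v'^T = 0 & M = c' *: (v'^T *m v')].
  have [M0|M0] := eqVneq M 0; last first.
    have /norP[c0 v0] : ~~ ((c == 0) || (v == 0)).
      by apply: contraNN M0; rewrite defM => /orP[]/eqP->;
         rewrite ?mulmx0 ?scale0r ?scaler0.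
    exists c, v; split=> //; move/eqP: qM.
    rewrite defM -scalemxAr mulmxA [q *m _]mx11_scalar mul_scalar_mx.
    rewrite !scaler_eq0.
    by rewrite (negPf c0) (negPf v0) orbF => /eqP->; rewrite raddf0.
  have [i qi] := row_neq0P _ q0.
  have [j ij] : exists j, i != j.
    by have [->|i0] := eqVneq i ord0; [exists ord_max | exists ord0].
  exists 0, (q 0 i *: delta_mx 0 j - q 0 j *: delta_mx 0 i).
  rewrite scale0r; split=> //.
    apply/row_neq0P; exists j; rewrite !mxE !eqxx [j == i]eq_sym (negPf ij).
    by rewrite mulr0 subr0 mulr1.
  rewrite -[q]trmxK -trmx_mul mulmxBl -!scalemxAl -!rowE.
  by apply/matrixP => a b; rewrite !mxE !ord1 mulrC subrr.
have [A [Au Aq Av]] := flag_basis q0 v'0 qv'.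
exists A, c'; split=> //; rewrite defM' -scalemxAr -scalemxAl mulmxA Av.
rewrite -mulmxA -[v' *m _]trmxK trmx_mul trmxK Av trmx_delta.
by rewrite mul_delta_mx.
Qed.

End RankOne.

(** * Weights of monomials, and type U6 in terms of the Hessian *)

Lemma mnm_weightD n (a : n.-tuple int) m1 m2 :
  mnm_weight a (m1 + m2)%MM = mnm_weight a m1 + mnm_weight a m2.
Proof.
rewrite -big_split; apply: eq_bigr => j _ /=.
by rewrite mnmDE PoszD mulrDl.
Qed.

Lemma mnm_weightU n (a : n.-tuple int) i : mnm_weight a U_(i)%MM = tnth a i.
Proof.
rewrite /mnm_weight (bigD1 i) //= big1 => [|j ji].
  by rewrite mnm1E eqxx mul1r addr0.
by rewrite mnm1E eq_sym (negPf ji) mul0r.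
Qed.

Lemma mdegS_split n d (m : 'X_{1..n}) : mdeg m = d.+1 ->
  exists i m', m = (m' + U_(i))%MM /\ mdeg m' = d.
Proof.
move=> md; have [i mi|m0] := pickP (fun i => m i != 0%N); last first.
  have /eqP : m = 0%MM.
    by apply/mnmP => i; have /negbFE/eqP -> := m0 i; rewrite mnm0E.
  by rewrite -mdeg_eq0 md.
have mE : m = (m - U_(i) + U_(i))%MM by rewrite submK ?lep1mP.
exists i, (m - U_(i))%MM; split=> //.
by move/(congr1 mdeg): mE; rewrite mdegD mdeg1 md addn1 => -[].
Qed.

Lemma u6_weight_ge (i : 'I_6) : -7 <= tnth u6_weights i.
Proof. by case: i => [[|[|[|[|[|[|//]]]]]] ?]. Qed.

Lemma u6_weight_ge_max (i : 'I_6) : i != ord_max -> -1 <= tnth u6_weights i.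
Proof. by case: i => [[|[|[|[|[|[|//]]]]]] ?]. Qed.

Lemma u6_weight_le (i : 'I_6) : i != ord0 -> tnth u6_weights i <= -1.
Proof. by case: i => [[|[|[|[|[|[|//]]]]]] ?]. Qed.

(** Differentiation multiplies the coefficient by positive integers, which are nonzero in
    characteristic 0. *)
Lemma hessian_at_delta_eq0 (K : numFieldType) n (h : {mpoly K[n]}) k a b :
  h \is 3.-homog ->
  (hessian_at h (delta_mx 0 k) a b == 0) = (h@_(U_(k) + U_(b) + U_(a)) == 0).
Proof.
move=> hh; rewrite mxE (@meval_dhomog1_delta _ _ _ _ k).
- by rewrite !mcoeff_deriv !mulrn_eq0.
- by do 2!apply: dhomog_mderiv.
- by move=> i; rewrite mxE.
Qed.

Lemma u6_suppP (K : numFieldType) (h : {mpoly K[6]}) : h \is 3.-homog ->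
  (forall m, m \in msupp h -> mnm_weight u6_weights m < 0) <->
  exists c, hessian_at h (delta_mx 0 ord0) = c *: delta_mx ord_max ord_max.
Proof.
move=> hh; split=> [neg|[c hessE] m mh].
  exists (hessian_at h (delta_mx 0 ord0) ord_max ord_max).
  apply/matrixP => a b; rewrite [RHS]mxE [X in _ * X]mxE.
  have [/andP[/eqP-> /eqP->]|ab] := boolP ((_ == _) && _).
    by rewrite mulr1.
  rewrite mulr0; apply/eqP; rewrite hessian_at_delta_eq0 //.
  apply: contraNT ab; rewrite -mcoeff_msupp => /neg.
  rewrite !mnm_weightD !mnm_weightU -[tnth _ ord0]/(11 : int).
  (* Unless [a] and [b] are both the last index, the weight is at least 11 - 1 - 7 = 3. *)
  have [-> |/u6_weight_ge_max wa] := eqVneq a ord_max.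
    have [-> //|/u6_weight_ge_max] := eqVneq b ord_max.
    by rewrite -[tnth _ ord_max]/(-7 : int); lia.
  by have := u6_weight_ge b; lia.
have md : mdeg m = 3 by apply: (dhomogP _ _ _ hh).
have [m0|m0] := eqVneq (m ord0) 0%N.
  (* Without ['X_0] every variable has weight at most -1, so a cubic monomial has weight at most
     -3. *)
  suff : mnm_weight u6_weights m <= - (mdeg m)%:Z by rewrite md; lia.
  rewrite mdegE -natz natr_sum -sumrN; apply: ler_sum => j _; rewrite natz.
  have [->|/u6_weight_le] := eqVneq j ord0; first by rewrite m0.
  by nia.
have mE : m = (m - U_(ord0) + U_(ord0))%MM by rewrite submK ?lep1mP.
(* The monomial is ['X_0] times two variables [a] and [b]; a nonzero Hessian entry forces both to be
   the last one, of total weight 11 - 14 = -3. *)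
have /mdegS_split[a [m1 [m1E /mdegS_split[b [m2 [m2E /eqP]]]]]] :
    mdeg (m - U_(ord0)) = 2.
  by move/(congr1 mdeg): mE; rewrite mdegD mdeg1 md addn1 => -[].
rewrite mdeg_eq0 => /eqP m20; move: mE mh.
rewrite m1E m2E m20 add0m addmC addmA => ->; rewrite mcoeff_msupp.
rewrite -hessian_at_delta_eq0 // hessE !mxE !mnm_weightD !mnm_weightU.
have [->|_] := eqVneq a ord_max; last by rewrite mulr0 eqxx.
by have [->|_] := eqVneq b ord_max; last by rewrite mulr0 eqxx.
Qed.

Lemma type_U6P (K : numFieldType) (f : dhomog 6 K 3) :
  type_U6 f <-> exists (A : 'M[K]_6) (c : K), A \in unitmx /\
    A *m hessian_at f (delta_mx 0 ord0 *m A) *m A^T =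
    c *: delta_mx ord_max ord_max.
Proof.
have hA (A : 'M[K]_6) := u6_suppP (dhomog_is_dhomog (lin_subst A f)).
split=> [[A Au /hA[c]]|[A [c [Au AH]]]]; rewrite ?hessian_at_lin_subst.
  by exists A, c.
by exists A => //; apply/hA; exists c; rewrite hessian_at_lin_subst.
Qed.

Lemma type_U6_iff_corank (K : numFieldType) (f : dhomog 6 K 3) :
  type_U6 f <-> has_singular_point_of_corank_ge 4 f.
Proof.
rewrite type_U6P has_singular_pointP; split=> [[A [c [Au AH]]]|[q [q0 qH rk]]].
  have ATu : A^T \in unitmx by rewrite unitmx_tr.
  exists (delta_mx 0 ord0 *m A); split.
  - apply: contraTneq (oner_neq0 K) => /(congr1 (mulmx^~ (invmx A))).
    rewrite mulmxK // mul0mx => /matrixP/(_ 0 ord0).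
    by rewrite !mxE !eqxx negbK => /eqP.
  (* After multiplication by the invertible [A^T], the claim reads off the first row of
     [c *: delta_mx ord_max ord_max], which is zero. *)
  - apply: (can_inj (mulmxK ATu)).
    rewrite -!mulmxA [A *m (_ *m _)]mulmxA AH mul0mx -scalemxAr.
    by rewrite mul_delta_mx_0 // scaler0.
  - set H := hessian_at _ _.
    have <- : \rank (A *m H *m A^T) = \rank H.
      rewrite mxrankMfree ?row_free_unit // (eqmxMfull H) //.
      by rewrite row_full_unit.
    rewrite AH; have [->|c0] := eqVneq c 0; first by rewrite scale0r mxrank0.
    by rewrite mxrank_scale_nz // mxrank_delta.
(* The corank is counted in 5 affine coordinates although the full Hessian has size 6, so corank at
   least 4 means rank at most 1. *)
have [|A [c [Au Aq AH]]] := rank_one_form_normalize q0 (trmx_hessian_at f q) qH.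
  by lia.
by exists A, c; rewrite Aq.
Qed.

(** * Instability of cones *)

Section Cone.

Variable K : numFieldType.

Lemma poly_evalZ (V : vectType K) (P : {mpoly K[\dim {: V}]}) k c v :
  P \is k.-homog -> poly_eval P (c *: v) = c ^+ k * poly_eval P v.
Proof. by move=> hP; apply: meval_dhomogZ => // i; rewrite linearZ. Qed.

Lemma comp_mpolyA l m n (f : {mpoly K[n]}) (t : n.-tuple {mpoly K[m]})
    (u : m.-tuple {mpoly K[l]}) :
  (f \mPo t) \mPo u = f \mPo [tuple tnth t i \mPo u | i < n].
Proof.
rewrite (comp_mpolyEX f) raddf_sum comp_mpolyEX; apply: eq_bigr => e _.
rewrite /= comp_mpolyZ !comp_mpolyX rmorph_prod; congr (_ *: _).
by apply: eq_bigr => i _; rewrite rmorphXn /= tnth_mktuple.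
Qed.

(** A diagonal left factor acts after [A], by rescaling the variables; this isolates its effect on
    the equation of a cone. *)
Lemma comp_lin_diag n (f : {mpoly K[n]}) (D : 'rV[K]_n) (A : 'M[K]_n) :
  f \mPo [tuple lin_image (diag_mx D *m A) i | i < n] =
  (f \mPo [tuple lin_image A i | i < n]) \mPo [tuple D 0 j *: 'X_j | j < n].
Proof.
rewrite comp_mpolyA; congr (_ \mPo _); apply: eq_from_tnth => i.
rewrite !tnth_mktuple /lin_image raddf_sum; apply: eq_bigr => j _ /=.
rewrite mul_diag_mx mxE comp_mpolyZ comp_mpolyXU -tnth_nth tnth_mktuple.
by rewrite scalerA mulrC.
Qed.

Lemma cone_unstable n d (f : dhomog n.+1 K d) :
  (0 < d)%N -> is_cone f -> unstable f.
Proof.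
move=> d0 [A [g [Au g0 /= fE]]] [k [P [k0 hP invP /negP]]]; apply.
have scale (s : K) : s != 0 ->
    poly_eval P f = s ^+ d ^+ k * poly_eval P (lin_subst A f).
  (* [a] compensates the determinant [s ^+ n * \det A]. Since the cone equation does not involve
     ['X_0], only the factor [s ^+ d] remains. *)
  move=> s0; pose a := (s ^+ n * \det A)^-1.
  pose D : 'rV[K]_n.+1 := \row_j if j == ord0 then a else s.
  have detDA : \det (diag_mx D *m A) = 1.
    rewrite det_mulmx det_diag big_ord_recl mxE eqxx.
    under eq_bigr => i _ do rewrite mxE /=.
    rewrite prodr_const card_ord /a -mulrA mulVf // mulf_neq0 ?expf_neq0 //.
    by rewrite -unitfE -unitmxE.
  rewrite -(invP _ f detDA) -poly_evalZ //; congr (poly_eval _ _).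
  apply/val_inj; rewrite /= comp_lin_diag fE comp_mpolyA.
  apply: comp_mpoly_dhomogZ => [|i]; first exact: dhomog_is_dhomog.
  by rewrite !tnth_mktuple comp_mpolyXU -tnth_nth tnth_mktuple mxE.
(* [s = 1] identifies the values of [P] at [f] and at [lin_subst A f]; then [s = 2] would force
   [2 ^ (d * k) = 1] if this value were nonzero, whereas [d * k] is positive. *)
have P0 := scale 1 (oner_neq0 _); rewrite !expr1n mul1r in P0.
have n20 : 2 != 0 :> K by rewrite pnatr_eq0.
apply: contraT => Pf0; have := scale 2 n20.
rewrite -P0 -{1}[poly_eval P f]mul1r => /(mulIf Pf0)/eqP.
rewrite -exprM -natrX eq_sym pnatr_eq1.
by rewrite gtn_eqF // -(expn0 2) ltn_exp2l // muln_gt0 d0.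
Qed.

End Cone.

Theorem lemma3p9 (R : realType) (Y : dhomog 6 R[i] 3) (Y_neq0 : Y != 0) :
  [/\ type_U6 Y -> has_singular_point_of_corank_ge 4 Y,
      has_singular_point_of_corank_ge 4 Y -> type_U6 Y
    & is_cone Y -> unstable Y].
Proof.
by split; [case: (type_U6_iff_corank Y) .. | apply: cone_unstable].
Qed.
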